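(* Suppose that, for every uniform Eberlein compact space $K$ of weight at most $\mathfrak{c}$, the Banach space $C(K)$ embeds isomorphically into $\ell_\infty/c_0$. Then for every binary relation $E\subseteq\mathbb{R}^2$ and for all but finitely many positive integers $n$, the set $E^{[n]}$ can be separated from $(E^c)^{[n]}$ by a member of $\mathcal{P}^n(\mathbb{R})$.
   Context: $\mathfrak{c}=2^{\aleph_0}$. For a compact space $K$, $C(K)$ is the Banach space of continuous real-valued functions on $K$ with the supremum norm. $\ell_\infty/c_0$ is the quotient Banach space of bounded real sequences modulo sequences converging to $0$, with norm $\|[x]\|=\limsup_n |x(n)|$. A Banach space $X$ embeds isomorphically into a Banach space $Y$ if there is a linear map $T:X\to Y$ that is an isomorphism (linear homeomorphism) onto its image $T(X)$. The weight of a topological space is the least cardinality of a base. A compact space is uniform Eberlein if it is homeomorphic to a subset of a Hilbert space equipped with its weak topology; equivalently, if it embeds, for some index set $\Gamma$, into $B(\Gamma)=\{x\in[-1,1]^\Gamma:\sum_{\gamma\in\Gamma}|x_\gamma|\leqslant 1\}$ with the product topology. For a natural number $n\geqslant 2$, $\mathcal{P}^n(\mathbb{R})$ is the $\sigma$-field of subsets of $\mathbb{R}^n$ generated by the sets $A_1\times\ldots\times A_n$ with $A_1,\ldots,A_n\subseteq\mathbb{R}$ arbitrary. For a binary relation $E\subseteq\mathbb{R}^2$ and an integer $n\geqslant 2$, $E^{[n]}=\{(x_1,\ldots,x_n)\in\mathbb{R}^n:\ \text{for all } i<j,\ x_i\neq x_j \text{ and } (x_i,x_j)\in E\}$, and $E^c=\mathbb{R}^2\setminus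 E$ is the complementary relation. A set $A$ is separated from a set $B$ by a set $S$ if $A\subseteq S$ and $S\cap B=\emptyset$. *)

(* Defs.v *)
From HB Require Import structures.
From mathcomp Require Import all_boot all_order all_algebra.
From mathcomp Require Import all_classical all_reals all_analysis.
Set Implicit Arguments.
Unset Strict Implicit.
Unset Printing Implicit Defensive.
Import Order.TTheory GRing.Theory Num.Theory.
Import numFieldNormedType.Exports.
Local Open Scope classical_set_scope.
Local Open Scope ring_scope.
Local Open Scope quotient_scope.

Definition topological_embedding (X Y : topologicalType) (f : X -> Y) : Prop :=
  [/\ injective f, continuous f &
      forall U : set X, open U ->
        exists2 V : set Y, open V & f @` U = V `&` range f].

Definition isomorphically_embeds (R : realType) (X Y : normedModType R) : Prop :=
  exists T : {linear X -> Y}, topological_embedding T.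

Definition eberlein_ball (R : realType) (G : choiceType)
    : set {ptws G -> R} :=
  [set x | (forall g, -1 <= x g <= 1) /\
           (\esum_(g in [set: G]) `|x g|%:E <= 1)%E].
Arguments eberlein_ball R G : clear implicits.

(* Equivalent to [K] being homeomorphic to a subset of a Hilbert space with its
   weak topology. The embedding makes [K] Hausdorff. *)
Definition uniform_eberlein (R : realType) (K : topologicalType) : Prop :=
  compact [set: K] /\
  exists (G : choiceType) (f : K -> {ptws G -> R}),
    topological_embedding f /\ range f `<=` eberlein_ball R G.

(* [#<=] compares cardinals, and [[set: set nat]] has cardinality continuum. *)
Definition weight_le_continuum (K : topologicalType) : Prop :=
  exists2 B : set (set K), basis B & (B #<= [set: set nat])%card.

Section continuous_functions.
Context (R : realType) (K : topologicalType).

Definition continuous_pred : {pred K -> R^o} :=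
  [pred f : K -> R^o | `[< continuous f >]].

Lemma continuous_pred_submod : submod_closed continuous_pred.
Proof.
split; first by apply/asboolP => x; exact: cvg_cst.
move=> a f g /asboolP cf /asboolP cg; apply/asboolP => x.
by apply: cvgD; [apply: cvgZr; exact: cf | exact: cg].
Qed.

HB.instance Definition _ := GRing.isSubmodClosed.Build R (K -> R^o)
  continuous_pred continuous_pred_submod.

(* The proof of compactness is a parameter so that the supremum norm below is
   a genuine norm. *)
Record contfun (cK : compact [set: K]) := ContFun {
  contfun_val :> K -> R^o;
  contfun_prop : contfun_val \in continuous_pred }.

Context (cK : compact [set: K]).
HB.instance Definition _ := [isSub for @contfun_val cK].
HB.instance Definition _ := [Choice of contfun cK by <:].
HB.instance Definition _ := [SubChoice_isSubLmodule of contfun cK by <:].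

Definition supnorm (f : contfun cK) : R := sup (range (fun x => `|f x|)).

Lemma contfun_continuous (f : contfun cK) : continuous f.
Proof. by have /asboolP := contfun_prop f. Qed.

Lemma has_ubound_contfun (f : contfun cK) : has_ubound (range (fun x => `|f x|)).
Proof.
have /compact_bounded[M [_ MK]] : compact (range f).
  apply: continuous_compact => //.
  by apply: continuous_subspaceT; exact: contfun_continuous.
exists (M + 1) => _ [x _ <-].
by apply: (MK (M + 1)); [rewrite ltrDl | exists x].
Qed.

Lemma supnorm_ub (f : contfun cK) (x : K) : `|f x| <= supnorm f.
Proof. by apply: ub_le_sup; [exact: has_ubound_contfun | exists x]. Qed.

Lemma supnorm_ge0 (f : contfun cK) : 0 <= supnorm f.
Proof.
rewrite /supnorm; have [->|/set0P[_ [x _ _]]] := eqVneq (range (fun x => `|f x|)) set0.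
  by rewrite sup0.
exact: le_trans (supnorm_ub f x).
Qed.

Lemma supnorm_le (f : contfun cK) (r : R) :
  0 <= r -> (forall x, `|f x| <= r) -> supnorm f <= r.
Proof.
move=> r0 fr; rewrite /supnorm.
have [->|/set0P ne] := eqVneq (range (fun x => `|f x|)) set0; first by rewrite sup0.
by apply: ge_sup => // _ [x _ <-].
Qed.

Lemma supnormD (f g : contfun cK) : supnorm (f + g) <= supnorm f + supnorm g.
Proof.
apply: supnorm_le => [|x]; first by rewrite addr_ge0 ?supnorm_ge0.
by rewrite (le_trans (ler_normD _ _))// lerD ?supnorm_ub.
Qed.

Lemma supnormZ (a : R) (f : contfun cK) : supnorm (a *: f) = `|a| * supnorm f.
Proof.
have leZ b (h : contfun cK) : supnorm (b *: h) <= `|b| * supnorm h.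
  apply: supnorm_le => [|x]; first by rewrite mulr_ge0 ?supnorm_ge0.
  by rewrite normrM ler_wpM2l ?supnorm_ub.
apply/eqP; rewrite eq_le leZ/=.
have [->|a0] := eqVneq a 0; first by rewrite normr0 mul0r supnorm_ge0.
rewrite -ler_pdivlMl ?normr_gt0// -normfV.
by rewrite -{1}(scale1r f) -(mulVf a0) -scalerA leZ.
Qed.

Lemma supnorm0_eq0 (f : contfun cK) : supnorm f = 0 -> f = 0.
Proof.
move=> f0; apply/val_inj/funext => x; apply/eqP.
by rewrite -normr_le0 -f0 supnorm_ub.
Qed.

HB.instance Definition _ := Lmodule_isNormed.Build R (contfun cK)
  supnormD supnormZ supnorm0_eq0.

End continuous_functions.

Section linfty_mod_c0.
Context (R : realType).

Definition bounded_pred : {pred nat -> R^o} :=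
  [pred u : nat -> R^o | `[< bounded_fun u >]].

Lemma bounded_pred_submod : submod_closed bounded_pred.
Proof.
split; first by apply/asboolP; exact: bounded_cst.
move=> a u v /asboolP bu /asboolP bv; apply/asboolP.
apply: bounded_funD => //; have [M [_ uM]] := bu.
exists (`|a| * (M + 1)); split; first exact: num_real.
move=> x ax n _; rewrite /= (le_trans _ (ltW ax))// normrM ler_wpM2l//.
by apply: uM; rewrite ?ltrDl.
Qed.

HB.instance Definition _ := GRing.isSubmodClosed.Build R (nat -> R^o)
  bounded_pred bounded_pred_submod.

Record linfty := Linfty {
  linfty_val :> nat -> R^o;
  linfty_prop : linfty_val \in bounded_pred }.

HB.instance Definition _ := [isSub for linfty_val].
HB.instance Definition _ := [Choice of linfty by <:].
HB.instance Definition _ := [SubChoice_isSubLmodule of linfty by <:].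

Definition c0 : {pred linfty} :=
  [pred u : linfty | `[< (u : nat -> R^o) @ \oo --> (0 : R^o) >]].

Lemma c0_submod : submod_closed c0.
Proof.
split; first by apply/asboolP; exact: cvg_cst.
move=> a u v /asboolP cu /asboolP cv; apply/asboolP.
rewrite -(addr0 0) -{1}(scaler0 _ a).
by apply: cvgD => //; exact: cvgZr.
Qed.

HB.instance Definition _ := GRing.isSubmodClosed.Build R linfty c0 c0_submod.

Lemma linfty_bounded (u : linfty) : bounded_fun (u : nat -> R^o).
Proof. by have /asboolP := linfty_prop u. Qed.

Definition limsup_abs (u : nat -> R^o) : R := limn_sup (fun n => `|u n|).

Lemma limsup_abs_leP (u : nat -> R^o) (r : R) : bounded_fun u ->
  limsup_abs u <= r <-> forall e, 0 < e -> \forall n \near \oo, `|u n| <= r + e.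
Proof.
move=> bu; have bn : bounded_fun (fun n => `|u n| : R^o).
  have [M [Mr uM]] := bu; exists M; split => // x /uM ux n _ /=.
  by rewrite normr_id; exact: ux.
have ubn k : has_ubound (sdrop (fun n => `|u n|) k).
  exact/has_ubound_sdrop/bounded_fun_has_ubound.
have lbs : has_lbound (range (sups (fun n => `|u n|))).
  exact: bounded_fun_has_lbound_sups.
rewrite /limsup_abs limn_supE//; split.
  move=> Lr e e0.
  have [] := @inf_lt _ (range (sups (fun n => `|u n|))) (r + e).
  - by exists (sups (fun n => `|u n|) 0%N), 0%N.
  - by rewrite (le_lt_trans Lr)// ltrDl.
  move=> _ [N _ <-] Ne; exists N => // n /= Nn.
  rewrite (le_trans _ (ltW Ne))//.
  by apply: ub_le_sup => //; exists n.
move=> ur; apply/ler_addgt0Pr => e /ur[N _ uN].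
apply: (@le_trans _ _ (sups (fun n => `|u n|) N)).
  by apply: ge_inf => //; exists N.
apply: ge_sup; first by exists `|u N|, N => /=.
by move=> _ [n /= Nn <-]; exact: uN.
Qed.

Lemma limsup_abs_ge0 (u : nat -> R^o) : bounded_fun u -> 0 <= limsup_abs u.
Proof.
move=> bu; apply/ler_addgt0Pr => e e0.
have /limsup_abs_leP /(_ _ e0)[//|N _ /(_ N)/= uN] := lexx (limsup_abs u).
by rewrite (le_trans _ (uN _)).
Qed.

Lemma limsup_absD (u v : linfty) :
  limsup_abs (u + v : linfty) <= limsup_abs u + limsup_abs v.
Proof.
apply/limsup_abs_leP => [|e e0]; first exact: linfty_bounded.
have e20 : 0 < e / 2 by rewrite divr_gt0.
have /limsup_abs_leP /(_ _ e20) := lexx (limsup_abs u).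
move=> /(_ (linfty_bounded u)) nu.
have /limsup_abs_leP /(_ _ e20) := lexx (limsup_abs v).
move=> /(_ (linfty_bounded v)) nv.
near=> n; rewrite (le_trans (ler_normD _ _))// (splitr e) addrACA lerD//.
  by near: n.
by near: n.
Unshelve. all: by end_near. Qed.

Lemma limsup_absZ (a : R) (u : linfty) :
  limsup_abs (a *: u : linfty) = `|a| * limsup_abs u.
Proof.
have leZ b (v : linfty) : limsup_abs (b *: v : linfty) <= `|b| * limsup_abs v.
  apply/limsup_abs_leP => [|e e0]; first exact: linfty_bounded.
  have e1 : 0 < e / (`|b| + 1) by rewrite divr_gt0// ltr_wpDl.
  have /limsup_abs_leP /(_ _ e1) := lexx (limsup_abs v).
  move=> /(_ (linfty_bounded v)); apply: filterS => n vn.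
  rewrite normrM (le_trans (ler_wpM2l _ vn))// mulrDr lerD2l.
  rewrite mulrCA ler_piMr ?(ltW e0)// ler_pdivrMr ?ltr_wpDl//.
  by rewrite mul1r lerDl.
apply/eqP; rewrite eq_le leZ andTb.
have [->|a0] := eqVneq a 0.
  by rewrite normr0 mul0r (limsup_abs_ge0 (linfty_bounded _)).
rewrite -ler_pdivlMl ?normr_gt0// -normfV.
by rewrite -{1}(scale1r u) -(mulVf a0) -scalerA leZ.
Qed.

Lemma limsup_abs_eq0 (u : linfty) : (limsup_abs u == 0) = (u \in c0).
Proof.
rewrite eq_le (limsup_abs_ge0 (linfty_bounded _)) andbT.
apply/idP/asboolP.
  move=> /limsup_abs_leP => /(_ (linfty_bounded u)) u0.
  apply/cvgrPdist_le => e /u0; apply: filterS => n.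
  by rewrite sub0r normrN add0r.
move=> /cvgrPdist_le u0.
apply/limsup_abs_leP => [|e /u0]; first exact: linfty_bounded.
by apply: filterS => n; rewrite sub0r normrN add0r.
Qed.

Lemma limsup_abs_c0 (u v : linfty) :
  u - v \in c0 -> limsup_abs u = limsup_abs v.
Proof.
have le (x y : linfty) : x - y \in c0 -> limsup_abs x <= limsup_abs y.
  rewrite -limsup_abs_eq0 => /eqP xy0.
  by rewrite -{1}(subrK y x) (le_trans (limsup_absD _ _))// xy0 add0r.
move=> uv; apply/eqP; rewrite eq_le !le//.
by rewrite -opprB rpredN.
Qed.

Definition linfty_c0 : Type := Quotient.quot c0.
HB.instance Definition _ := GRing.Zmodule.on linfty_c0.

Definition linfty_c0_class (u : linfty) : linfty_c0 := \pi_(Quotient.quot c0) u.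

Local Notation class := linfty_c0_class.

Lemma linfty_c0_classP (u v : linfty) : class u = class v <-> u - v \in c0.
Proof. by rewrite Quotient.idealrBE; split=> /eqP. Qed.

Lemma linfty_c0_classD (u v : linfty) : class (u + v) = class u + class v.
Proof. exact: raddfD. Qed.

Lemma linfty_c0_reprK (q : linfty_c0) : class (repr q) = q.
Proof. exact: reprK. Qed.

Definition linfty_c0_scale (a : R) (q : linfty_c0) : linfty_c0 :=
  class (a *: repr q).

Lemma linfty_c0_scaleE (a : R) (u : linfty) :
  linfty_c0_scale a (class u) = class (a *: u).
Proof.
apply/linfty_c0_classP; rewrite -scalerBr rpredZ//.
by apply/linfty_c0_classP; rewrite linfty_c0_reprK.
Qed.

Lemma linfty_c0_scaleA (a b : R) (q : linfty_c0) :
  linfty_c0_scale a (linfty_c0_scale b q) = linfty_c0_scale (a * b) q.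
Proof. by rewrite -(linfty_c0_reprK q) !linfty_c0_scaleE scalerA. Qed.

Lemma linfty_c0_scale1 : left_id 1 linfty_c0_scale.
Proof. by move=> q; rewrite -(linfty_c0_reprK q) linfty_c0_scaleE scale1r. Qed.

Lemma linfty_c0_scaleDr : right_distributive linfty_c0_scale +%R.
Proof.
move=> a p q; rewrite -(linfty_c0_reprK p) -(linfty_c0_reprK q).
by rewrite -linfty_c0_classD !linfty_c0_scaleE -linfty_c0_classD scalerDr.
Qed.

Lemma linfty_c0_scaleDl (q : linfty_c0) :
  {morph linfty_c0_scale^~ q : a b / a + b}.
Proof.
move=> a b; rewrite -(linfty_c0_reprK q) !linfty_c0_scaleE.
by rewrite -linfty_c0_classD scalerDl.
Qed.

HB.instance Definition _ := GRing.Zmodule_isLmodule.Build R linfty_c0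
  linfty_c0_scaleA linfty_c0_scale1 linfty_c0_scaleDr linfty_c0_scaleDl.

Definition linfty_c0_norm (q : linfty_c0) : R := limsup_abs (repr q).

Lemma linfty_c0_normE (u : linfty) : linfty_c0_norm (class u) = limsup_abs u.
Proof. by apply/limsup_abs_c0/linfty_c0_classP; exact: linfty_c0_reprK. Qed.

Lemma linfty_c0_normD (p q : linfty_c0) :
  linfty_c0_norm (p + q) <= linfty_c0_norm p + linfty_c0_norm q.
Proof.
rewrite -(linfty_c0_reprK p) -(linfty_c0_reprK q) -linfty_c0_classD.
by rewrite !linfty_c0_normE limsup_absD.
Qed.

Lemma linfty_c0_normZ (a : R) (q : linfty_c0) :
  linfty_c0_norm (a *: q) = `|a| * linfty_c0_norm q.
Proof. by rewrite linfty_c0_normE limsup_absZ. Qed.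

Lemma linfty_c0_norm0_eq0 (q : linfty_c0) : linfty_c0_norm q = 0 -> q = 0.
Proof.
move=> /eqP; rewrite limsup_abs_eq0 => q0.
rewrite -(linfty_c0_reprK q) -[RHS](raddf0 \pi_(Quotient.quot c0)).
by apply/linfty_c0_classP; rewrite subr0.
Qed.

HB.instance Definition _ := Lmodule_isNormed.Build R linfty_c0
  linfty_c0_normD linfty_c0_normZ linfty_c0_norm0_eq0.

End linfty_mod_c0.

Definition rectangle (R : Type) (n : nat) (A : 'I_n -> set R)
    : set ('I_n -> R) :=
  [set x | forall i, A i (x i)].

Definition rectangle_sigma_field (R : Type) (n : nat)
    : set (set ('I_n -> R)) :=
  <<s range (@rectangle R n) >>.
Arguments rectangle_sigma_field R n : clear implicits.

Definition homogeneous_tuples (R : Type) (E : set (R * R)) (n : nat)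
    : set ('I_n -> R) :=
  [set x | forall i j : 'I_n, (i < j)%N -> x i <> x j /\ E (x i, x j)].
Arguments homogeneous_tuples {R} E n.

Definition separates (T : Type) (S A B : set T) : Prop :=
  A `<=` S /\ S `&` B = set0.

(* Main.v *)
Require Import Defs.
From mathcomp Require Import all_boot all_order all_algebra.
From mathcomp Require Import all_classical all_reals all_analysis.
From mathcomp Require Import measurable_realfun.
Import Order.TTheory GRing.Theory Num.Theory.
Import numFieldNormedType.Exports.
Local Open Scope classical_set_scope.
Local Open Scope ring_scope.

(* Consider the compact space of partial sequences of reals whose
   i-th and j-th terms, i < j, are related by E, and the coordinate functions
   f(i, z), equal to 1 when the i-th term is z and to 0 otherwise. The sum of
   the f(i, x_i), i < n, has norm n when x is E-homogeneous, and norm at most 1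
   when x is homogeneous for the complement of E, since then at most one of its
   terms is nonzero at a given point. An embedding T into l_oo/c_0 with
   r |f| <= |T f| <= C |f| keeps these norms apart as soon as r n > C. If
   u(i, z) is a bounded sequence representing T f(i, z), the set of those x for
   which the limsup of |sum_i u(i, x_i)| is larger than C is a separating set,
   and it is measurable because each term of the sum depends on one coordinate
   only. *)

(** * Compactness of subspaces and norm bounds for embeddings *)

Lemma compact_set_type (X : topologicalType) (A : set X) :
  compact A -> compact [set: A].
Proof.
move=> cA F PF _.
have FA : (set_val @ F) A.
  suff : F (set_val @^-1` A) by [].
  by apply: filterS filterT => x _; exact: set_valP.
have [p [Ap clp]] := cA _ _ FA.
exists (SigSub (mem_set Ap)); split => // B V FB [_ [[W oW <-] Wp] WV].
have FvB : (set_val @ F) (set_val @` B).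
  suff : F (set_val @^-1` (set_val @` B)) by [].
  by apply: filterS FB; exact: preimage_image.
have [_ [[x Bx <-] Wx]] := clp _ W FvB (open_nbhs_nbhs (conj oW Wp)).
by exists x; split => //; exact: WV.
Qed.

(** The lower bound comes from openness onto the range: some ball of radius [r] around 0 meets the
    range only inside the image of the unit ball. *)
Lemma topological_embedding_bounds (R : realType) (X Y : normedModType R)
    (T : {linear X -> Y}) : topological_embedding T ->
  exists C r : R, [/\ 0 <= C, 0 < r & forall f, r * `|f| <= `|T f| <= C * `|f|].
Proof.
move=> [Tinj Tcont Topen].
have /linear_bounded_continuous/linear_boundedP[C [_ TC]] := Tcont.
have [V oV TV] := Topen _ (@ball_open _ _ (0 : X) 1).
have V0 : V 0.
  suff [] : (V `&` range T) 0 by [].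
  by rewrite -TV; exists 0; [exact: ballxx|exact: linear0].
have /nbhs_ballP[r /= r0 rV] := open_nbhs_nbhs (conj oV V0).
exists (`|C| + 1), r; split => [||f] //.
apply/andP; split; last first.
  by apply: TC; rewrite (le_lt_trans (ler_norm C))// ltrDl.
rewrite leNgt; apply/negP => Tf.
have f0 : 0 < `|f|.
  by rewrite -(pmulr_rgt0 _ r0); exact: le_lt_trans Tf.
(* If the lower bound failed, the image of the normalized [f] would lie in [V], and injectivity
   would put a vector of norm 1 in the open unit ball. *)
have : (V `&` range T) (T (`|f|^-1 *: f)).
  split; last by exists (`|f|^-1 *: f).
  apply: rV; rewrite -ball_normE/= sub0r normrN linearZ/= normrZ.
  by rewrite normfV normr_id mulrC ltr_pdivrMr.
rewrite -TV => -[g + /Tinj gf]; rewrite gf -ball_normE/= sub0r normrN normrZ.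
by rewrite normfV normr_id mulVf ?ltxx// gt_eqF.
Qed.

(** * Measurability for the rectangle sigma-field *)

Section measurability.
Context (R : realType) (n : nat).
Local Notation T := (g_sigma_algebraType (range (@rectangle R n))).

Lemma measurable_coordinate (i : 'I_n) (h : R -> R) :
  measurable_fun [set: T] (fun x : T => h (x i)).
Proof.
move=> _ Y mY; rewrite setTI; apply: sub_sigma_algebra.
(* Any preimage under [h] may be a side of a rectangle; the sides other than the [i]-th are the
   whole line. *)
exists (fun j => [set z | j = i -> Y (h z)]) => //.
by apply/seteqP; split => [x /= /(_ i erefl)//|x Yx j ->].
Qed.

Lemma limsup_gt_rectangle_sigma_field (u : 'I_n -> R -> linfty R) (a : R) :
  rectangle_sigma_field R n
    [set x | a < limsup_abs (\sum_(i < n) u i (x i) : linfty R)].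
Proof.
have sumE (x : 'I_n -> R) k :
    (\sum_(i < n) u i (x i) : linfty R) k = \sum_(i < n) u i (x i) k.
  pose ev (v : linfty R) := v k.
  by rewrite -[LHS]/(ev _); apply: (big_morph ev).
have mf : measurable_fun [set: T]
    (fun x : T => limsup_abs (\sum_(i < n) u i (x i) : linfty R)).
  apply: measurable_fun_limn_sup => [x _|x _|k].
  - have [M [_ uM]] := linfty_bounded (\sum_(i < n) u i (x i)).
    exists (M + 1) => _ [k _ <-].
    by apply: uM => //; rewrite ltrDl.
  - by exists 0 => _ [k _ <-].
  - rewrite [X in measurable_fun _ X](_ : _ =
      (fun x : T => `|\sum_(i < n) u i (x i) k|)); last first.
      by apply/funext => x; rewrite sumE.
    apply: measurableT_comp => //; apply: measurable_sum => i.
    exact: (measurable_coordinate i (fun z => u i z k)).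
have := mf measurableT _ (measurable_itv `]a, +oo[).
rewrite setTI; set S := _ @^-1` _.
suff -> : [set x |
  a < limsup_abs (\sum_(i < n) u i (x i) : linfty R)] = S by [].
by apply/seteqP; split => x; rewrite /S/= in_itv/= andbT.
Qed.

End measurability.

(** * Finite lists of reals coded by sets of naturals *)

Section coding.
Context (R : realType).

(* A real is coded by the rationals below it; as there always are some, every
   entry of the list leaves a trace in its code. *)
Definition code (s : seq ((nat * R) * bool)) : set nat :=
  [set k | exists i (q : rat) (c : (nat * R) * bool),
    [/\ onth s i = Some c, ratr q < c.1.2 & k = pickle (i, q, c.1.1, c.2)]].

(** Inclusion of cuts yields only an inequality between reals; [code_inj] combines two opposite
    ones. *)
Lemma code_subset s t i (c : (nat * R) * bool) :
  code s `<=` code t -> onth s i = Some c ->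
  exists d, [/\ onth t i = Some d, c.1.1 = d.1.1, c.2 = d.2 & c.1.2 <= d.1.2].
Proof.
move=> st sic.
have qP (q : rat) : ratr q < c.1.2 ->
    exists d, [/\ onth t i = Some d, c.1.1 = d.1.1, c.2 = d.2 & ratr q < d.1.2].
  move=> qc; have [|j [q' [d [tj qd]]]] := st (pickle (i, q, c.1.1, c.2)).
    by exists i, q, c.
  move=> /(pcan_inj pickleK)[ij qq' c1 c2].
  by exists d; rewrite ij qq'.
(* One rational below the real locates entry [i] of [t]; a rational in the gap would then contradict
   the inclusion. *)
have /rat_in_itvoo[q0] : c.1.2 - 1 < c.1.2 by rewrite ltrBlDr ltrDl.
rewrite in_itv/= => /andP[_ /qP[d [tid cd1 cd2 _]]].
exists d; split => //; rewrite leNgt; apply/negP => /rat_in_itvoo[q].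
rewrite in_itv/= => /andP[dq /qP[d' [td' _ _]]].
by move: td'; rewrite tid => -[<-] /(lt_trans dq); rewrite ltxx.
Qed.

Lemma code_inj : injective code.
Proof.
have onth_code s t i (c : (nat * R) * bool) :
    code s = code t -> onth s i = Some c -> onth t i = Some c.
  move=> st sic.
  have [|d [tid c1 c2 cd]] := code_subset s t i c _ sic; first by rewrite st.
  have [|e [sie _ _ de]] := code_subset t s i d _ tid; first by rewrite st.
  move: sie; rewrite sic => -[ce]; rewrite -ce in de.
  have c3 : c.1.2 = d.1.2 by apply/eqP; rewrite eq_le cd de.
  rewrite tid; case: c d c1 c2 c3 {cd de ce sic tid} => [[? ?] ?] [[? ?] ?].
  by move=> /= -> -> ->.
move=> s t st; apply: eq_from_onth => i.
case si : (onth s i) => [c|]; first by rewrite (onth_code _ _ _ _ st si).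
by case ti : (onth t i) => [c|//]; rewrite -si (onth_code _ _ _ _ (esym st) ti).
Qed.

End coding.

(** * The uniform Eberlein compact space of partial sequences *)

Section chain_space.
Context (R : realType) (E : set (R * R)).
Implicit Types c d : nat * R.

(* Their sum over any family of points with pairwise distinct first coordinates
   is at most 1. *)
Definition weight c : R := (2 ^ (c.1 + 1))%:R^-1.

Definition conflict c d : Prop :=
  (c.1 = d.1 /\ c.2 <> d.2) \/ ((c.1 < d.1)%N /\ ~ E (c.2, d.2)).

(* The support of a point is the graph of a partial sequence of reals. *)
Definition chain_space : set {ptws nat * R -> R} :=
  [set g | (forall c, g c = 0 \/ g c = weight c) /\
           (forall c d, conflict c d -> g c = 0 \/ g d = 0)].

Lemma weight_gt0 c : 0 < weight c.
Proof. by rewrite invr_gt0 ltr0n expn_gt0. Qed.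

Lemma weight_neq0 c : weight c != 0.
Proof. by rewrite gt_eqF ?weight_gt0. Qed.

Lemma continuous_coordinate c : continuous (fun g : {ptws nat * R -> R} => g c).
Proof. exact: proj_continuous. Qed.

(** The product of two-point sets is compact by Tychonoff, and each conflict is the closed condition
    that a product of two coordinates vanishes. *)
Lemma compact_chain_space : compact chain_space.
Proof.
have -> : chain_space =
    [set g : {ptws nat * R -> R} | forall c, [set 0; weight c] (g c)] `&`
    \bigcap_(p in [set p | conflict p.1 p.2])
      (fun g : {ptws nat * R -> R} => g p.1 * g p.2) @^-1` [set 0].
  apply/seteqP; split => g [gw gQ]; split => //.
    by move=> [c d] /= /gQ[]->; rewrite ?mul0r ?mulr0.
  move=> c d cd; have /eqP := gQ (c, d) cd.
  by rewrite /= mulf_eq0 => /orP[]/eqP ->; [left|right].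
apply: compact_closedI.
  by apply: (@tychonoff _ _ (fun c => [set 0; weight c])) => c;
    exact: finite_compact.
apply: closed_bigI => -[c d] _; apply: closed_comp; last exact: closed_eq.
move=> g _.
exact: (cvgM (@continuous_coordinate c g) (@continuous_coordinate d g)).
Qed.

(** Points of a support never conflict, so [fst] is injective on it and the sum is dominated by a
    geometric series of ratio 1/2. *)
Lemma chain_space_eberlein : chain_space `<=` eberlein_ball R (nat * R)%type.
Proof.
move=> g [gw gQ].
have g0 c : 0 <= g c by have [->|->] := gw c; rewrite ?lexx ?ltW ?weight_gt0.
split=> [c|].
  rewrite (le_trans _ (g0 c))//=.
  have [->|->] := gw c; first exact: ler01.
  by rewrite invf_le1 ?ltr0n ?ler1n expn_gt0.
have -> : (\esum_(c in [set: nat * R]) `|g c|%:E =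
    \esum_(c in [set c | g c != 0%R]) (weight c)%:E)%E.
  rewrite [RHS]esum_mkcond; apply: eq_esum => c _.
  rewrite ger0_norm//; have [gc|gc] := gw c.
    by rewrite memNset/= gc ?eqxx.
  by rewrite mem_set/= gc ?weight_neq0.
pose h i : \bar R := ((1 / (2 ^ (i + 1))%:R)%:E)%E.
have -> : (\esum_(c in [set c | g c != 0%R]) (weight c)%:E =
    \esum_(i in fst @` [set c | g c != 0%R]) h i)%E.
  rewrite esum_image; first by apply: eq_esum => c _; rewrite /h div1r.
  move=> c d; rewrite !inE/= => gc gd cd; apply: contrapT => cNd.
  have [] : g c = 0 \/ g d = 0.
  - apply: gQ; left; split => // cd2; apply: cNd.
    by rewrite [c]surjective_pairing [d]surjective_pairing cd cd2.
  - by move/eqP; rewrite (negPf gc).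
  - by move/eqP; rewrite (negPf gd).
have h0 i : (0 <= h i)%E by rewrite lee_fin divr_ge0.
have <- : (\sum_(i <oo) h i = 1)%E.
  apply: cvg_lim => //.
  by have := @cvg_geometric_eseries_half R 1 0; rewrite divr1.
rewrite nneseries_esumT// [leLHS]esum_mkcond.
by apply: le_esum => i _; case: ifP.
Qed.

(** Each coordinate has only two values, so recording which ones vanish describes neighbourhoods;
    indexing by lists lets [code] count the base. *)
Definition cylinder (s : seq ((nat * R) * bool)) : set chain_space :=
  [set g | all (fun p => (set_val g p.1 != 0) == p.2) s].

Lemma cylinder_open s : open (cylinder s).
Proof.
have neq_open c (a : R) : open [set g : chain_space | set_val g c != a].
  exists [set g : {ptws nat * R -> R} | g c != a] => //.
  apply: (@open_comp _ _ (fun g : {ptws nat * R -> R} => g c) [set x | x != a]).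
    by move=> g _; exact: continuous_coordinate.
  exact: open_neq.
elim: s => [|[c b] s IH].
  rewrite (_ : cylinder _ = setT); first exact: openT.
  by apply/seteqP; split.
rewrite (_ : cylinder _ = [set g | (set_val g c != 0) == b] `&` cylinder s);
  last by apply/seteqP; split => g /= /andP.
apply: openI => //; case: b.
  by under eq_set do rewrite eqb_id; exact: neq_open.
(* Vanishing is an open condition too: it means differing from the other possible value. *)
rewrite (_ : [set _ | _] = [set g | set_val g c != weight c]).
  exact: neq_open.
apply/seteqP; split => g /=;
  have [gw _] : chain_space (set_val g) := set_valP g.
  by rewrite eqbF_neg negbK => /eqP ->; rewrite eq_sym weight_neq0.
by have [->|->] := gw c; rewrite eqxx.
Qed.

Lemma cylinder_basis : basis (range cylinder).
Proof.
split=> [_ [s _ <-]|x]; first exact: cylinder_open.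
(* [F] is generated by the cylinders around [x]; its convergence to [x] is checked one coordinate at
   a time. *)
set F := filter_from _ _.
have FF : Filter F.
  apply: filter_from_filter.
    by exists setT; split => //; exists [::] => //; apply/seteqP; split.
  move=> _ _ [[s _ <-] sx] [[t _ <-] tx].
  exists (cylinder s `&` cylinder t) => //; split => //; exists (s ++ t) => //.
  by apply/seteqP; split => g; rewrite /cylinder/= all_cat => /andP.
have Fx : (set_val @ F) --> (set_val x : {ptws nat * R -> R}).
  apply/cvg_sup => c V [_ [[W oW <-] Wx] WV].
  exists (cylinder [:: (c, set_val x c != 0)]).
    by split; [exists [:: (c, set_val x c != 0)]|rewrite /cylinder/= eqxx].
  move=> g; rewrite /cylinder/= andbT => /eqP gx; apply: WV => /=.
  suff -> : set_val g c = set_val x c by [].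
  have [gw _] : chain_space (set_val g) := set_valP g.
  have [xw _] : chain_space (set_val x) := set_valP x.
  move: gx.
  by have [->|->] := gw c; have [->|->] := xw c => //;
    rewrite eqxx ?weight_neq0// (negPf (weight_neq0 _)).
move=> V [_ [[W oW <-] Wx] WV].
have : F (set_val @^-1` W) by apply: Fx; exact: open_nbhs_nbhs.
exact: filterS.
Qed.

Lemma chain_space_weight : weight_le_continuum chain_space.
Proof.
exists (range cylinder); first exact: cylinder_basis.
apply: card_le_trans (card_image_le _ _) _.
by apply/pcard_injP; exists (@code R) => s t _ _; exact: code_inj.
Qed.

End chain_space.

(** * Norms of sums of coordinate functions *)

Section tuple_sums.
Context (R : realType) (E : set (R * R)).
Context (cK : compact [set: chain_space R E]).

Lemma normalized_coordinate_continuous (c : nat * R) :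
  (fun g : chain_space R E => (weight R c)^-1 * set_val g c : R^o)
    \in @continuous_pred R _.
Proof.
apply/asboolP => g.
have cg : {for g, continuous (fun h : chain_space R E => set_val h c)}.
  exact: (continuous_comp (@initial_continuous _ _ set_val g)
    (@continuous_coordinate R c (set_val g))).
exact: (cvgM (cvg_cst _) cg).
Qed.

(** Dividing by the weight makes the values 0 and 1, so the weights chosen for summability do not
    affect the norms below. *)
Definition normalized_coordinate (c : nat * R) : contfun R cK :=
  ContFun cK (normalized_coordinate_continuous c).

Definition tuple_sum (n : nat) (x : 'I_n -> R) : contfun R cK :=
  \sum_(i < n) normalized_coordinate (i : nat, x i).

Lemma tuple_sumE n (x : 'I_n -> R) (g : chain_space R E) :
  tuple_sum n x g =
  \sum_(i < n) (weight R (i : nat, x i))^-1 * set_val g (i : nat, x i).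
Proof.
pose ev (f : contfun R cK) := f g.
by rewrite -[LHS]/(ev _); apply: (big_morph ev).
Qed.

Lemma le_norm_tuple_sum n (x : 'I_n -> R) :
  homogeneous_tuples E n x -> n%:R <= `|tuple_sum n x|.
Proof.
move=> xE.
(* The point supported on the graph of [x]: homogeneity excludes conflicts, and all [n] terms equal
   1 there. *)
pose g : {ptws nat * R -> R} := fun c =>
  if `[< exists i : 'I_n, c = (i : nat, x i) >] then weight R c else 0.
have gK : chain_space R E g.
  split=> [c|c d cd]; first by rewrite /g; case: ifP; [right|left].
  rewrite /g; case: asboolP => [[i ci]|_]; last by left.
  case: asboolP => [[j dj]|_]; last by right.
  move: cd; rewrite ci dj => -[[/= /val_inj -> //]|[/= ij]].
  by have [_] := xE _ _ ij.
have gx (i : 'I_n) : g (i : nat, x i) = weight R (i : nat, x i).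
  by rewrite /g asboolT//; exists i.
have -> : n%:R = tuple_sum n x (SigSub (mem_set gK)).
  rewrite tuple_sumE (eq_bigr (fun=> 1)) ?sumr_const ?card_ord// => i _.
  by rewrite -[set_val _]/g gx mulVf// weight_neq0.
exact: le_trans (ler_norm _) (supnorm_ub _ _).
Qed.

(** Two terms nonzero at [g] would have indices [i < j] with [(x i, x j)] outside [E], which is a
    conflict. *)
Lemma norm_tuple_sum_le1 n (x : 'I_n -> R) :
  homogeneous_tuples (~` E) n x -> `|tuple_sum n x| <= 1.
Proof.
move=> xE; apply: supnorm_le => // g; rewrite tuple_sumE.
have [gw gQ] : chain_space R E (set_val g) := set_valP g.
have [[i gi]|gx0] := pselect (exists i : 'I_n, set_val g (i : nat, x i) <> 0).
  rewrite (bigD1 i)//= big1 ?addr0 => [|j ji].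
    have [->|->] := gw (i : nat, x i); first by rewrite mulr0 normr0.
    by rewrite mulVf ?normr1// weight_neq0.
  suff -> : set_val g (j : nat, x j) = 0 by rewrite mulr0.
  have [ij|ij|/val_inj ij] := ltngtP i j.
  - have [_ nE] := xE _ _ ij.
    by have [//|//|//] := gQ (i : nat, x i) (j : nat, x j); right.
  - have [_ nE] := xE _ _ ij.
    by have [//|//|//] := gQ (j : nat, x j) (i : nat, x i); right.
  - by rewrite ij eqxx in ji.
rewrite big1 ?normr0// => i _.
have [->|gi] := eqVneq (set_val g (i : nat, x i)) 0.
  by rewrite mulr0.
by case: gx0; exists i; apply/eqP.
Qed.

End tuple_sums.

(** * Separation by the limsup threshold *)

Theorem theorem3p4 (R : realType)
  (universality : forall (K : topologicalType) (cK : compact [set: K]),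
    uniform_eberlein R K -> weight_le_continuum K ->
    isomorphically_embeds (contfun R cK) (linfty_c0 R))
  (E : set (R * R)) :
  finite_set [set n : nat | (0 < n)%N /\
    ~ exists2 S : set ('I_n -> R), rectangle_sigma_field R n S &
        separates S (homogeneous_tuples E n) (homogeneous_tuples (~` E) n)].
Proof.
pose cK := compact_set_type _ _ (compact_chain_space R E).
have [|T /topological_embedding_bounds[C [r [C0 r0 Tbound]]]] :=
    universality _ cK _ (chain_space_weight R E).
  split=> //; exists (nat * R)%type, set_val; split; last first.
    by move=> _ [g _ <-]; apply: chain_space_eberlein; exact: set_valP.
  split; [exact: val_inj|exact: initial_continuous|].
  move=> U [W oW <-]; exists W => //.
  apply/seteqP; split=> [_ [g Wg <-]|h [Wh [g _ gh]]].
    by split => //; exists g.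
  by exists g => //=; rewrite gh.
(* [Num.bound (C / r)] exceeds [C / r], so [r * n > C] for all [n] outside this initial segment. *)
apply: (@sub_finite_set _ _ `I_(Num.bound (C / r)).+1); last exact: finite_II.
move=> n [_ nS] /=; rewrite ltnNge; apply/negP => Nn; apply: nS.
pose u (i : 'I_n) z :=
    repr (T (normalized_coordinate R E cK (i : nat, z))) : linfty R.
(* By linearity of [T] and of the quotient map, the sum of representatives represents the image of
   the tuple sum. *)
have uE x :
      limsup_abs (\sum_(i < n) u i (x i)) = `|T (tuple_sum R E cK n x)|.
  rewrite -linfty_c0_normE; congr linfty_c0_norm.
  have class0 : @linfty_c0_class R 0 = 0 by exact: raddf0.
  rewrite linear_sum (big_morph _ (@linfty_c0_classD R) class0).
  by apply: eq_bigr => i _; exact: linfty_c0_reprK.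
exists [set x | C < limsup_abs (\sum_(i < n) u i (x i))].
  exact: limsup_gt_rectangle_sigma_field.
split=> [x /(le_norm_tuple_sum R E cK) nx|].
  rewrite /= uE; have /andP[+ _] := Tbound (tuple_sum R E cK n x).
  apply: lt_le_trans; apply: lt_le_trans (ler_wpM2l (ltW r0) nx).
  rewrite mulrC -ltr_pdivrMr//; apply: lt_le_trans (_ : _ <= n%:R).
    by apply: archi_boundP; rewrite divr_ge0 ?(ltW r0).
  by rewrite ler_nat ltnW.
apply/seteqP; split => // x [/=]; rewrite uE => Cx.
move=> /(norm_tuple_sum_le1 R E cK) x1; move: Cx; rewrite ltNge => /negP; apply.
have /andP[_ /le_trans] := Tbound (tuple_sum R E cK n x); apply.
by rewrite ler_piMr.
Qed.
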